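(* Let $n\ge 2$, $k\ge 2$ and $K>k$ be integers. If $K=1+(k-1)N$ for some integer $N\ge 1$, then $nG_{K,1}\le nG_{k,1}$, i.e., $nG_{K,1}$ is isomorphic to a subgroup of $nG_{k,1}$. In particular, for all $K>2$, $nG_{K,1}\le nG_{2,1}$.
   Context: For an integer $k\ge 1$ let $A_k=\{a_0,\dots,a_{k-1}\}$ be an alphabet with $k$ letters. For an alphabet $A$, $A^*$ is the set of finite strings over $A$ (with empty string $\varepsilon$) and $A^\omega$ the set of infinite strings indexed by $\omega$. $nA^*$ is the $n$-fold direct product of the free monoid $A^*$ with coordinatewise concatenation, and $nA^\omega$ is the $n$-fold cartesian product of $A^\omega$. For $u,v\in nA^*$, $u\le_{\rm init} v$ iff $v=ux$ for some $x\in nA^*$; the join $u\vee v$ is the $\le_{\rm init}$-least common upper bound of $u$ and $v$ (it exists iff for every $i$, one of $u_i,v_i$ is a prefix of the other). A joinless code is a set $S\subseteq nA^*$ in which no two distinct elements have a join; it is maximal if it is $\subseteq$-maximal among joinless codes of $nA^*$. ''Function'' means partial function. A right-ideal morphism of $nA^*$ is a function $f:nA^*\to nA^*$ with $f(xw)=f(x)w$ for all $x\in{\rm Dom}(f)$, $w\in nA^*$. $n\mathcal{RI}^{\sf fin}$ is the monoid (under composition) of injective right-ideal morphisms $f$ such that ${\rm Dom}(f)={\rm domC}(f)\cdot nA^*$ and ${\rm Im}(f)={\rm imC}(f)\cdot nA^*$ for finite maximal joinless codes ${\rm domC}(f)$, ${\rm imC}(f)$. Such $f$ is determined by the bijection ${\rm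 domC}(f)\to{\rm imC}(f)$ (its table), and it induces a permutation $f^{(\omega)}$ of $nA^\omega$ by $f^{(\omega)}(pu)=f(p)\,u$ for $p\in{\rm domC}(f)$, $u\in nA^\omega$. For $n\ge1$, $k\ge2$, the Brin-Higman-Thompson group $nG_{k,1}$ is the group of all permutations $f^{(\omega)}$ of $nA_k^{\,\omega}$ with $f\in n\mathcal{RI}^{\sf fin}$ over the alphabet $A_k$. *)

(* Defs.v *)
From HB Require Import structures.
From mathcomp Require Import all_boot.
From mathcomp Require Import mathcomp_extra boolp classical_sets cardinality.

Set Implicit Arguments.
Unset Strict Implicit.
Unset Printing Implicit Defensive.

Local Open Scope classical_set_scope.

Record sym (T : Type) := Sym {
  sym_fun :> T -> T;
  sym_inv : T -> T;
  sym_funK : cancel sym_fun sym_inv;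
  sym_invK : cancel sym_inv sym_fun }.

Section SymGroup.
Variable T : Type.
Implicit Types g h : sym T.

Lemma sym_eq g h : sym_fun g =1 sym_fun h -> g = h.
Proof.
case: g h => [f f' fK f'K] [h h' hK h'K] /= /funext fh; subst h.
have fh' : f' = h' by apply/funext => y; rewrite -{1}(h'K y) fK.
by subst h'; rewrite (Prop_irrelevance fK hK) (Prop_irrelevance f'K h'K).
Qed.

Definition sym_one := @Sym T id id (fun=> erefl) (fun=> erefl).
Definition sym_mul g h :=
  Sym (can_comp (sym_funK g) (sym_funK h)) (can_comp (sym_invK h) (sym_invK g)).
Definition sym_opp g := Sym (sym_invK g) (sym_funK g).

HB.instance Definition _ := gen_eqMixin (sym T).
HB.instance Definition _ := gen_choiceMixin (sym T).

Lemma sym_mulA : associative sym_mul.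
Proof. by move=> f g h; apply: sym_eq. Qed.
Lemma sym_mul1 : left_id sym_one sym_mul.
Proof. by move=> f; apply: sym_eq. Qed.
Lemma sym_mulr1 : right_id sym_one sym_mul.
Proof. by move=> f; apply: sym_eq. Qed.
Lemma sym_mulV : left_inverse sym_one sym_opp sym_mul.
Proof. by move=> f; apply: sym_eq => x; exact: sym_funK. Qed.
Lemma sym_mulrV : right_inverse sym_one sym_opp sym_mul.
Proof. by move=> f; apply: sym_eq => x; exact: sym_invK. Qed.

HB.instance Definition _ := isGroup.Build (sym T)
  sym_mulA sym_mul1 sym_mulr1 sym_mulV sym_mulrV.

End SymGroup.

Section Words.
Variables n k : nat.

(* [word] is nA^* and [ends] is nA^omega, with alphabet A_k = 'I_k. *)
Definition word := 'I_n -> seq 'I_k.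
Definition ends := 'I_n -> nat -> 'I_k.

Definition weps : word := fun=> [::].
Definition wcat (u v : word) : word := fun i => u i ++ v i.

Definition prepend (s : seq 'I_k) (x : nat -> 'I_k) : nat -> 'I_k :=
  foldr (fun a y j => if j is j'.+1 then y j' else a) x s.
Definition wact (u : word) (x : ends) : ends := fun i => prepend (u i) (x i).

Definition init_le (u v : word) := exists x, v = wcat u x.

Definition is_join (u v w : word) :=
  [/\ init_le u w, init_le v w &
      forall z, init_le u z -> init_le v z -> init_le w z].

Definition joinless (S : set word) :=
  forall u v, S u -> S v -> u <> v -> ~ exists w, is_join u v w.

Definition maximal_joinless (S : set word) :=
  joinless S /\ forall T, joinless T -> S `<=` T -> T = S.

Definition rideal (S : set word) : set word :=
  [set z | exists p w, S p /\ z = wcat p w].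

(* The code [C] is determined by the right ideal [I] (it is the set of
   [init_le]-minimal elements of [I]), so that domC(f) and imC(f) below are
   well defined. *)
Definition fin_code_of (C I : set word) :=
  [/\ finite_set C, maximal_joinless C & I = rideal C].

Definition pfun := word -> option word.
Implicit Types f : pfun.

Definition Dom f : set word := [set x | exists y, f x = Some y].
Definition Im f : set word := [set y | exists x, f x = Some y].

Definition right_ideal_morphism f :=
  forall x y w, f x = Some y -> f (wcat x w) = Some (wcat y w).

Definition pinjective f :=
  forall x x' y, f x = Some y -> f x' = Some y -> x = x'.

Definition is_domC f C := fin_code_of C (Dom f).
Definition is_imC f D := fin_code_of D (Im f).

Definition nRIfin f :=
  [/\ right_ideal_morphism f, pinjective f,
      exists C, is_domC f C & exists D, is_imC f D].

(* [g] is f^(omega); this determines [g], since every point of [ends] has a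
   prefix in the finite maximal joinless code [C] (lemma [maximal_covers]). *)
Definition is_omega f (g : ends -> ends) :=
  exists2 C, is_domC f C &
    forall p q u, C p -> f p = Some q -> g (wact p u) = wact q u.

Definition BHT : {pred sym ends} :=
  [pred g : sym ends | `[< exists2 f, nRIfin f & is_omega f g >] ].

Lemma init_leP u v : init_le u v <-> forall i, prefix (u i) (v i).
Proof.
split=> [[x ->] i|H]; first by apply/prefixP; exists (x i).
exists (fun i => drop (size (u i)) (v i)); apply/funext => i.
by have /prefixP[s] := H i; rewrite /wcat => ->; rewrite drop_size_cat.
Qed.

Lemma init_le_refl u : init_le u u.
Proof. by apply/init_leP => i; exact: prefix_refl. Qed.

Lemma init_le_trans v u w : init_le u v -> init_le v w -> init_le u w.
Proof.
by move=> /init_leP uv /init_leP vw; apply/init_leP => i; exact: prefix_trans.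
Qed.

Lemma wcatA u v w : wcat (wcat u v) w = wcat u (wcat v w).
Proof. by apply/funext => i; rewrite /wcat catA. Qed.

Lemma wcat0 u : wcat u weps = u.
Proof. by apply/funext => i; rewrite /wcat cats0. Qed.

Lemma wcatI u : injective (wcat u).
Proof.
move=> v w /(congr1 (fun z : word => z _)) => H; apply/funext => i.
by have := H i; rewrite /wcat => /eqP; rewrite eqseq_cat // eqxx => /eqP.
Qed.

Definition compat (u v : word) := exists2 z, init_le u z & init_le v z.

Lemma compat_sym u v : compat u v -> compat v u.
Proof. by case=> z; exists z. Qed.

Definition wjoin (u v : word) : word :=
  fun i => if size (u i) <= size (v i) then v i else u i.

Lemma prefix_total (s t r : seq 'I_k) :
  size s <= size t -> prefix s r -> prefix t r -> prefix s t.
Proof.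
rewrite !prefixE => st /eqP sr /eqP tr.
by rewrite -[in X in take _ X]tr take_takel // sr.
Qed.

Lemma compat_join u v : compat u v -> is_join u v (wjoin u v).
Proof.
case=> z /init_leP uz /init_leP vz; split.
- apply/init_leP => i; rewrite /wjoin; case: ifP => uv; last exact: prefix_refl.
  exact: prefix_total uv (uz i) (vz i).
- apply/init_leP => i; rewrite /wjoin; case: ifPn => uv; first exact: prefix_refl.
  by apply: prefix_total (vz i) (uz i); rewrite ltnW // ltnNge.
- move=> w /init_leP uw /init_leP vw; apply/init_leP => i.
  by rewrite /wjoin; case: ifP.
Qed.

Lemma joinless_compat S u v : joinless S -> S u -> S v -> compat u v -> u = v.
Proof.
move=> jS Su Sv uv; have [//|nuv] := pselect (u = v).
by case: (jS u v Su Sv nuv); exists (wjoin u v); exact: compat_join.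
Qed.

Lemma prependD s t x : prepend (s ++ t) x = prepend s (prepend t x).
Proof. by rewrite /prepend foldr_cat. Qed.

Lemma wact_cat u v x : wact (wcat u v) x = wact u (wact v x).
Proof. by apply/funext => i; exact: prependD. Qed.

Lemma prepend_eq s t x y : prepend s x = prepend t y -> size s <= size t ->
  exists2 r, t = s ++ r & x = prepend r y.
Proof.
elim: s t => [|a s IH] [|b t] //= e st; try by [exists [::] | exists (b :: t)].
have ab : a = b by exact: (congr1 (fun z : nat -> 'I_k => z 0) e).
have e' : prepend s x = prepend t y.
  by apply/funext => j; exact: (congr1 (fun z : nat -> 'I_k => z j.+1) e).
by have [r -> ->] := IH _ e' st; exists r; rewrite ?ab.
Qed.

Lemma wact_le u v x y : wact u x = wact v y ->
  (forall i, size (u i) <= size (v i)) -> exists2 r, v = wcat u r & x = wact r y.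
Proof.
move=> e uv.
have H i : exists r, v i = u i ++ r /\ x i = prepend r (y i).
  have [|r] := @prepend_eq (u i) (v i) (x i) (y i) _ (uv i); last by exists r.
  exact: (congr1 (fun z : ends => z i) e).
exists (fun i => projT1 (cid (H i))); apply/funext => i;
  by rewrite /wcat /wact; case: cid => r [].
Qed.

Lemma wactI u : injective (wact u).
Proof.
move=> x y /wact_le [] // r + ->; rewrite -{1}(wcat0 u) => /wcatI <-.
by [].
Qed.

Lemma wact_compat u v x y : wact u x = wact v y -> compat u v.
Proof.
move=> e; exists (wjoin u v); apply/init_leP => i; rewrite /wjoin;
  have ei := congr1 (fun z : ends => z i) e; case: ifPn => uv;
  rewrite ?prefix_refl //; apply/prefixP.
  by have [r -> _] := prepend_eq ei uv; exists r.
rewrite -ltnNge in uv.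
by have [r -> _] := prepend_eq (esym ei) (ltnW uv); exists r.
Qed.

Lemma wact_join u v x y : wact u x = wact v y ->
  exists z, wact u x = wact (wjoin u v) z.
Proof.
move=> e; exists (fun i => if size (u i) <= size (v i) then y i else x i).
apply/funext => i; rewrite /wact /wjoin.
by have := congr1 (fun z : ends => z i) e; rewrite /wact; case: ifP.
Qed.

Definition covers (S : set word) := forall x, exists p y, S p /\ x = wact p y.

Lemma prepend_mkseq (x : nat -> 'I_k) m :
  x = prepend (mkseq x m) (fun j => x (m + j)).
Proof.
elim: m x => [|m IH] x //.
rewrite /mkseq -[m.+1]addn1 addnC iotaD map_cat /= (iotaDl 1 0) -map_comp.
apply/funext => -[|j] //=.
exact: (congr1 (fun z : nat -> 'I_k => z j) (IH (x \o succn))).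
Qed.

Lemma finite_bound (S : set word) : finite_set S ->
  exists m, forall p i, S p -> size (p i) <= m.
Proof.
move=> /finite_seqP[s ->]; exists (\max_(p <- s) \max_(i < n) size (p i)).
move=> p i /= ps; rewrite (big_rem p ps) /= leq_max; apply/orP; left.
exact: (@leq_bigmax _ (fun i => size (p i))).
Qed.

Lemma maximal_covers S : finite_set S -> maximal_joinless S -> covers S.
Proof.
move=> finS [jS maxS] x; have [m mP] := finite_bound finS.
pose t : word := fun i => mkseq (x i) m.
pose y : ends := fun i j => x i (m + j).
have xt : x = wact t y.
  by apply/funext => i; exact: prepend_mkseq.
suff [p Sp pt] : exists2 p, S p & compat p t.
  case: pt => z /init_leP pz /init_leP tz.
  have /init_leP[r tr] : forall i, prefix (p i) (t i).
    by move=> i; apply: prefix_total (pz i) (tz i); rewrite size_mkseq mP.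
  by exists p, (wact r y); split; rewrite // xt tr wact_cat.
apply: contrapT => nS.
have nSt p : S p -> ~ compat p t by move=> Sp pt; apply: nS; exists p.
have : S t.
  rewrite -(maxS (S `|` [set t])); [by right| |by left].
  move=> u v [Su|->] [Sv|->] // uv [w [uw vw _]].
  - by apply: jS uv _ => //; exists (wjoin u v); apply: compat_join; exists w.
  - by apply: (nSt u) => //; exists w.
  - by apply: (nSt v) => //; exists w.
by move=> St; apply: (nSt t St); exists t; exact: init_le_refl.
Qed.

Lemma covers_maximal (x : ends) S : joinless S -> covers S -> maximal_joinless S.
Proof.
move=> jS cS; split=> // T jT ST; apply/seteqP; split=> // t Tt.
have [p [y [Sp e]]] := cS (wact t x).
by rewrite (joinless_compat jT Tt (ST _ Sp) (wact_compat e)).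
Qed.

Section Pullback.
Variables (f : pfun) (C D J : set word).
Hypotheses (rif : right_ideal_morphism f) (injf : pinjective f).
Hypotheses (fC : is_domC f C) (fD : is_imC f D).

Lemma Dom_code p : C p -> exists q, f p = Some q.
Proof.
case: fC => _ _ e Cp; suff: Dom f p by [].
by rewrite e; exists p, weps; rewrite wcat0.
Qed.

Lemma image_code p q : C p -> f p = Some q -> D q.
Proof.
move=> Cp pq; have [_ _ eC] := fC; have [_ _ eD] := fD.
have : Im f q by exists p.
rewrite eD => -[d [w [Dd qd]]].
have : Im f d by rewrite eD; exists d, weps; rewrite wcat0.
case=> p' p'd.
have pp' : p = wcat p' w by apply: injf pq _; rewrite qd; exact: rif.
have : Dom f p' by exists d.
rewrite eC => -[c [v [Cc p'c]]].
have [_ [jC _] _] := fC.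
have cp : c = p.
  apply: joinless_compat jC Cc Cp _; exists p; last exact: init_le_refl.
  by exists (wcat v w); rewrite pp' p'c wcatA.
have p0 : wcat p weps = wcat p (wcat v w).
  by rewrite wcat0 {1}pp' p'c cp wcatA.
have /(congr1 (fun z : word => z _)) e := wcatI p0.
suff w0 : w = weps by rewrite qd w0 wcat0.
apply/funext => i; have := e i; rewrite /wcat /weps.
by case: (v i) => //=; case: (w i).
Qed.

Hypotheses (finJ : finite_set J) (mJ : maximal_joinless J) (JD : J `<=` Im f).

Definition pull : set word := [set x | exists2 j, J j & f x = Some j].

Lemma pull_code (x0 : ends) :
  fin_code_of pull [set x | exists2 y, rideal J y & f x = Some y].
Proof.
have [jJ _] := mJ.
have jpull : joinless pull.
  move=> p p' [j Jj pj] [j' Jj' pj'] npp' [w [[x wx] [x' wx'] _]]; apply: npp'.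
  have e : Some (wcat j x) = Some (wcat j' x').
    by rewrite -(rif x pj) -(rif x' pj') -wx -wx'.
  suff jj' : j = j' by apply: injf pj _; rewrite jj'.
  apply: joinless_compat jJ Jj Jj' _; exists (wcat j x); first by exists x.
  by case: e => ->; exists x'.
split.
- pose h (j : word) : word :=
    if pselect (exists x, f x = Some j) is left e then projT1 (cid e) else weps.
  apply: (@sub_finite_set _ _ (h @` J)); last exact: finite_image.
  move=> x [j Jj xj]; exists j => //; rewrite /h.
  case: pselect => [e|[]]; last by exists x.
  by case: cid => x' /= x'j; exact: injf x'j xj.
- apply: (covers_maximal x0 jpull) => x.
  have [finC mC eC] := fC; have [_ [jD _] eD] := fD.
  have [c [u [Cc ->]]] := maximal_covers finC mC x.
  have [d cd] := Dom_code Cc.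
  have [j [v [Jj dj]]] := maximal_covers finJ mJ (wact d u).
  have [y yj] := JD Jj.
  have : Dom f y by exists j.
  rewrite eC => -[c' [w [Cc' yc']]].
  have [d' cd'] := Dom_code Cc'.
  have jd' : j = wcat d' w.
    by have := rif w cd'; rewrite -yc' yj => -[].
  have e : wact d u = wact d' (wact w v) by rewrite dj jd' wact_cat.
  have dd' : d = d'.
    apply: joinless_compat jD (image_code Cc cd) (image_code Cc' cd') _.
    exact: wact_compat e.
  have cc' : c = c' by apply: injf cd _; rewrite dd'.
  exists y, v; split; first by exists j.
  rewrite yc' wact_cat cc'; congr wact; apply: (@wactI d).
  by rewrite e dd'.
- apply/seteqP; split=> x /=.
    case=> y [j [w [Jj ->]]] xy; have [p pj] := JD Jj.
    exists p, w; split; first by exists j.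
    by apply: injf xy _; exact: rif.
  case=> p [w [[j Jj pj] ->]]; exists (wcat j w); last exact: rif.
  by exists j, w.
Qed.

End Pullback.

Definition code_join (C D : set word) : set word :=
  [set z | exists c d, [/\ C c, D d, compat c d & z = wjoin c d]].

Section CodeJoin.
Variables C D : set word.
Hypotheses (finC : finite_set C) (mC : maximal_joinless C).
Hypotheses (finD : finite_set D) (mD : maximal_joinless D).

Lemma code_join_finite : finite_set (code_join C D).
Proof.
apply: (@sub_finite_set _ _ [set wjoin c d | c in C & d in D]).
  by move=> z [c [d [Cc Dd _ ->]]]; exists c => //; exists d.
exact: finite_image2.
Qed.

Lemma code_join_maximal (x0 : ends) : maximal_joinless (code_join C D).
Proof.
have [jC _] := mC; have [jD _] := mD; apply: (covers_maximal x0).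
  move=> u v [c [d [Cc Dd cd ->]]] [c' [d' [Cc' Dd' cd' ->]]] + [w [uw vw _]].
  have [cj dj _] := compat_join cd; have [cj' dj' _] := compat_join cd'.
  have -> : c = c'.
    apply: joinless_compat jC Cc Cc' _.
    by exists w; [exact: init_le_trans cj uw|exact: init_le_trans cj' vw].
  have -> // : d = d'.
  apply: joinless_compat jD Dd Dd' _.
  by exists w; [exact: init_le_trans dj uw|exact: init_le_trans dj' vw].
move=> x; have [c [u [Cc xc]]] := maximal_covers finC mC x.
have [d [v [Dd xd]]] := maximal_covers finD mD x.
have e : wact c u = wact d v by rewrite -xc.
have [z xz] := wact_join e.
exists (wjoin c d), z; split; last by rewrite -xz.
by exists c, d; split=> //; exact: wact_compat e.
Qed.

Lemma code_join_rideal : rideal (code_join C D) = rideal C `&` rideal D.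
Proof.
apply/seteqP; split=> z.
  case=> _ [w [[c [d [Cc Dd cd ->]]] ->]].
  have [[u cu] [v dv] _] := compat_join cd.
  split; [exists c, (wcat u w)|exists d, (wcat v w)]; split=> //.
    by rewrite cu wcatA.
  by rewrite dv wcatA.
case=> -[c [u [Cc zc]]] [d [v [Dd zd]]].
have cz : init_le c z by exists u.
have dz : init_le d z by exists v.
have cd : compat c d by exists z.
have [_ _ /(_ z cz dz)[w zw]] := compat_join cd.
by exists (wjoin c d), w; split=> //; exists c, d.
Qed.

End CodeJoin.

Lemma omega_Dom f g p q u : right_ideal_morphism f -> is_omega f g ->
  f p = Some q -> g (wact p u) = wact q u.
Proof.
move=> rif [C [_ _ eC] gP] pq.
have : Dom f p by exists q.
rewrite eC => -[c [w [Cc pc]]].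
have [d cd] : Dom f c by rewrite eC; exists c, weps; rewrite wcat0.
have := rif _ _ w cd; rewrite -pc pq => -[->].
by rewrite pc !wact_cat; exact: gP.
Qed.

Definition pinv f : pfun := fun y =>
  if pselect (exists x, f x = Some y) is left e then Some (projT1 (cid e))
  else None.

Lemma pinvP f x y : pinjective f -> pinv f y = Some x <-> f x = Some y.
Proof.
move=> injf; rewrite /pinv; case: pselect => [e|ne].
  case: cid => x' /= x'y; split=> [[<-]//|xy].
  by rewrite (injf _ _ _ xy x'y).
by split=> // xy; case: ne; exists x.
Qed.

Lemma pinv_ri f : pinjective f -> right_ideal_morphism f ->
  right_ideal_morphism (pinv f).
Proof.
by move=> injf rif y x w /(pinvP _ _ injf) xy; apply/pinvP => //; exact: rif.
Qed.

Lemma pinv_inj f : pinjective f -> pinjective (pinv f).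
Proof.
move=> injf y y' x /(pinvP _ _ injf) xy /(pinvP _ _ injf).
by rewrite xy => -[].
Qed.

Lemma Dom_pinv f : pinjective f -> Dom (pinv f) = Im f.
Proof.
by move=> injf; apply/seteqP; split=> y [x /(pinvP _ _ injf)]; exists x => //;
  apply/pinvP.
Qed.

Lemma Im_pinv f : pinjective f -> Im (pinv f) = Dom f.
Proof.
by move=> injf; apply/seteqP; split=> x [y /(pinvP _ _ injf)]; exists y => //;
  apply/pinvP.
Qed.

Lemma BHTP (g : sym ends) :
  reflect (exists2 f, nRIfin f & is_omega f g) (g \in BHT).
Proof. by rewrite inE; exact: asboolP. Qed.

Lemma BHT1 : 1%g \in BHT.
Proof.
have code0 : fin_code_of [set weps] setT.
  split; first exact: finite_set1.
    split=> [u v -> -> //|T jT sT]; apply/seteqP; split=> // t Tt /=.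
    apply: joinless_compat jT Tt (sT _ erefl) _; exists t.
      exact: init_le_refl.
    by exists t.
  by apply/seteqP; split=> // z _; exists weps, z.
have dom1 : Dom (@Some word) = setT by apply/seteqP; split=> // x _; exists x.
have im1 : Im (@Some word) = setT by apply/seteqP; split=> // x _; exists x.
apply/BHTP; exists (@Some word).
  split=> [x y w [->]//|x x' y [->] [->]//||]; exists [set weps].
    by rewrite /is_domC dom1.
  by rewrite /is_imC im1.
by exists [set weps]; rewrite /is_domC ?dom1 // => p q u _ [->].
Qed.

Lemma BHTV : {in BHT, forall g, (g^-1)%g \in BHT}.
Proof.
move=> g /BHTP[f [rif injf [C fC] [D fD]] fg]; apply/BHTP; exists (pinv f).
  split; [exact: pinv_ri|exact: pinv_inj|exists D|exists C].
    by rewrite /is_domC Dom_pinv.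
  by rewrite /is_imC Im_pinv.
exists D; first by rewrite /is_domC Dom_pinv.
move=> q p u Dq /(pinvP _ _ injf) pq.
by rewrite -(omega_Dom u rif fg pq); exact: (sym_funK g).
Qed.

Lemma BHTM : {in BHT &, forall g h, (g * h)%g \in BHT}.
Proof.
move=> g2 g1 /BHTP[f2 [ri2 inj2 [C2 fC2] [D2 fD2]] fg2].
move=> /BHTP[f1 [ri1 inj1 [C1 fC1] [D1 fD1]] fg1].
have [[x0]|nx] := pselect (inhabited ends); last first.
  suff -> : (g2 * g1)%g = 1%g by exact: BHT1.
  by apply: sym_eq => x; case: nx.
have [finC2 mC2 eC2] := fC2; have [finD1 mD1 eD1] := fD1.
pose J := code_join D1 C2.
have finJ : finite_set J by exact: code_join_finite.
have mJ : maximal_joinless J by exact: code_join_maximal.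
have rJ : rideal J = Im f1 `&` Dom f2 by rewrite code_join_rideal // eD1 eC2.
have sJ : J `<=` Im f1 `&` Dom f2.
  by move=> j Jj; rewrite -rJ; exists j, weps; rewrite wcat0.
pose f : pfun := fun x => obind f2 (f1 x).
have fP x y : f x = Some y <-> exists2 z, f1 x = Some z & f2 z = Some y.
  rewrite /f; split=> [|[z -> //]].
  by case: (f1 x) => //= z; exists z.
have rif : right_ideal_morphism f.
  move=> x y w /fP[z xz zy]; apply/fP.
  by exists (wcat z w); [exact: ri1|exact: ri2].
have injf : pinjective f.
  move=> x x' y /fP[z xz zy] /fP[z' xz' zy'].
  by apply: inj1 xz _; rewrite (inj2 _ _ _ zy zy').
have domf : is_domC f (pull f1 J).
  rewrite /is_domC; have -> : Dom f =
      [set x | exists2 y, rideal J y & f1 x = Some y].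
    rewrite rJ; apply/seteqP; split=> x /=.
      by case=> y /fP[z xz zy]; exists z => //; split; [exists x|exists y].
    by case=> z [_ [y zy]] xz; exists y; apply/fP; exists z.
  apply: (pull_code ri1 inj1 fC1 fD1) => // z /sJ[] //.
have imf : is_imC f (pull (pinv f2) J).
  rewrite /is_imC; have -> : Im f =
      [set y | exists2 z, rideal J z & pinv f2 y = Some z].
    rewrite rJ; apply/seteqP; split=> y /=.
      case=> x /fP[z xz zy]; exists z; last exact/pinvP.
      by split; [exists x|exists y].
    by case=> z [[x xz] _] /(pinvP _ _ inj2) zy; exists x; apply/fP; exists z.
  apply: (@pull_code _ D2 C2) => //.
  - exact: pinv_ri.
  - exact: pinv_inj.
  - by rewrite /is_domC Dom_pinv.
  - by rewrite /is_imC Im_pinv.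
  - by rewrite Im_pinv // => z /sJ[].
apply/BHTP; exists f; first by split=> //; eexists; eassumption.
exists (pull f1 J) => // p q u _ /fP[z pz zq].
change (g2 (g1 (wact p u)) = wact q u).
by rewrite (omega_Dom u ri1 fg1 pz) (omega_Dom u ri2 fg2 zq).
Qed.

Lemma BHT_group_closed : group_closed BHT.
Proof. by split=> [|g h Gg Gh]; [exact: BHT1|exact: BHTM (BHTV Gh)]. Qed.

Record nG := NG { nG_val :> sym ends; nG_valP : nG_val \in BHT }.

HB.instance Definition _ := [isSub for nG_val].
HB.instance Definition _ := [Choice of nG by <:].
HB.instance Definition _ :=
  SubChoice_isSubGroup.Build (sym ends) (mem BHT) nG BHT_group_closed.

End Words.

Definition isomorphic_to_subgroup (G H : groupType) :=
  exists2 S : {pred H}, group_closed S &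
    exists phi : {multiplicative G -> H},
      injective phi /\ forall y, y \in S <-> exists x, phi x = y.

(* Main.v *)
(* Since K = 1 + (k-1)N, the tree of words over A_k has a complete prefix code
   with K leaves.  Replacing the i-th letter of A_K by the i-th code word gives
   a bijection A_K^omega -> A_k^omega, and conjugation by this bijection, taken
   coordinatewise, sends a permutation with table p |-> q to the permutation
   with the table obtained by substituting in p and q. *)
From HB Require Import structures.
Require Import Defs.
From mathcomp Require Import all_boot.
From mathcomp Require Import boolp classical_sets cardinality.

Set Implicit Arguments.
Unset Strict Implicit.
Unset Printing Implicit Defensive.

(** * Membership in [BHT] read off from tables *)

Section Tables.
Variables n k : nat.
Variable x0 : ends n k.
Implicit Types u v p q : word n k.
Local Open Scope classical_set_scope.

Lemma compat_wact u v : compat u v -> exists x y, wact u x = wact v y.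
Proof.
case=> _ [a ->] [b e]; exists (wact a x0), (wact b x0).
by rewrite -!wact_cat e.
Qed.

(** A join of [u] and [v], prolonged by [x0], would be an end common to both cylinders, so it is
    enough that distinct words have disjoint cylinders. *)
Lemma joinless_wact (C : set (word n k)) :
  (forall u v x y, C u -> C v -> wact u x = wact v y -> u = v) -> joinless C.
Proof.
move=> H u v Cu Cv nuv [w [uw vw _]]; apply: nuv.
have [|x [y e]] := @compat_wact u v; first by exists w.
exact: H e.
Qed.

(* As [g] is a bijection of [ends], the images of the code words form a finite
   maximal joinless code automatically. *)
Lemma BHT_table (g : sym (ends n k)) :
  g \in @BHT n k <->
  exists C, [/\ finite_set C, maximal_joinless C &
    forall p, C p -> exists q, forall x, g (wact p x) = wact q x].
Proof.
split=> [/BHTP[f _ [C fC gP]]|[C [finC mC tab]]].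
  exists C; have [finC mC _] := fC; split=> // p Cp.
  by have [q pq] := Dom_code fC Cp; exists q => x; exact: gP.
have [jC _] := mC.
have /boolp.choice[h hP] p :
    exists q, C p -> forall x, g (wact p x) = wact q x.
  have [/tab[q qP]|nCp] := pselect (C p); first by exists q.
  by exists p.
have Ceq c c' x y : C c -> C c' -> wact c x = wact c' y -> c = c'.
  by move=> Cc Cc' /wact_compat; exact: (joinless_compat jC).
(* Since [g] is injective, it carries the disjoint cylinders of [C] to disjoint cylinders. *)
have heq c c' x y : C c -> C c' -> wact (h c) x = wact (h c') y -> c = c'.
  move=> Cc Cc'; rewrite -!hP // => /(can_inj (sym_funK g)).
  exact: Ceq.
(* The graph of the right-ideal morphism with table [c |-> h c]; single-valuedness is tested on
   ends, after appending [x0]. *)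
pose r z y := exists c w, [/\ C c, z = wcat c w & y = wcat (h c) w].
have r_fun z y y' : r z y -> r z y' -> y = y'.
  move=> [c [w [Cc -> ->]]] [c' [w' [Cc' e ->]]].
  have cc' : c = c'.
    by apply: (Ceq _ _ (wact w x0) (wact w' x0)) => //; rewrite -!wact_cat e.
  by rewrite cc' in e *; rewrite (wcatI e).
pose f z := if pselect (exists y, r z y) is left e then Some (projT1 (cid e))
            else None.
have fP z y : f z = Some y <-> r z y.
  rewrite /f; case: pselect => [e|ne]; last by split=> // zy; case: ne; exists y.
  by case: cid => y' /= zy'; split=> [[<-]//|zy]; rewrite (r_fun _ _ _ zy zy').
have domf : is_domC f C.
  split=> //; apply/seteqP; split=> z.
    by move=> [y /fP[c [w [Cc zc _]]]]; exists c, w.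
  by move=> [c [w [Cc zc]]]; exists (wcat (h c) w); apply/fP; exists c, w.
have imf : is_imC f (h @` C).
  split; first exact: finite_image.
    apply: (covers_maximal x0).
      apply: joinless_wact => _ _ x y [c Cc <-] [c' Cc' <-].
      by move=> /heq ->.
    (* Since [g] is onto, a cylinder of [C] containing the preimage of [x] is mapped to one
       containing [x]. *)
    move=> x; have [c [y [Cc e]]] := maximal_covers finC mC (sym_inv g x).
    exists (h c), y; split; first by exists c.
    by rewrite -hP // -e sym_invK.
  apply/seteqP; split=> z.
    move=> [y /fP[c [w [Cc _ zc]]]]; exists (h c), w.
    by split=> //; exists c.
  move=> [_ [w [[c Cc <-] ->]]]; exists (wcat c w); apply/fP.
  by exists c, w.
apply/BHTP; exists f.
  split; [| |by exists C|by exists (h @` C)].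
    move=> x y w /fP[c [v [Cc -> ->]]]; apply/fP.
    by exists c, (wcat v w); rewrite !wcatA.
  move=> x x' y /fP[c [v [Cc -> ->]]] /fP[c' [v' [Cc' -> e]]].
  have cc' : c = c'.
    by apply: (heq _ _ (wact v x0) (wact v' x0)) => //; rewrite -!wact_cat e.
  by rewrite cc' in e *; rewrite (wcatI e).
exists C => // p q u Cp /fP[c [w [Cc pc ->]]].
by rewrite pc !wact_cat hP.
Qed.

End Tables.

(** * Complete prefix codes in one coordinate *)

Lemma prependI k (s : seq 'I_k) : injective (prepend s).
Proof.
move=> x y; elim: s => //= a s IH e; apply: IH.
by apply/funext => j; exact: (congr1 (fun z => z j.+1) e).
Qed.

(** A nonempty prefix shifts the tail by at least one place. This strict gain makes the recursions
    and inductions on positions below go through. *)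
Lemma prepend_local k (s : seq 'I_k) (x y : nat -> 'I_k) j : 0 < size s ->
  (forall i, i < j -> x i = y i) -> prepend s x j = prepend s y j.
Proof.
case: s => //= a s _; case: j => // j; elim: s j => [|b s IH] j xy /=.
  exact: xy.
by case: j xy => // j xy; apply: IH => i ij; apply: xy; exact: ltnW.
Qed.

Lemma prepend1 k (x : nat -> 'I_k) : x = prepend [:: x 0] (x \o succn).
Proof. by apply/funext => -[|j]. Qed.

(* [s] lists the leaves of a comb-shaped tree with [N] inner nodes. *)
Lemma complete_prefix_code k N : exists s : seq (seq 'I_k.+1),
  [/\ uniq s, size s = (k * N).+1,
      forall x, exists w y, w \in s /\ x = prepend w y &
      forall v w x y, v \in s -> w \in s -> prepend v x = prepend w y -> v = w].
Proof.
elim: N => [|N [s [us ss cs ps]]].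
  exists [:: [::]]; split=> //; first by rewrite muln0.
    by move=> x; exists [::], x.
  by move=> v w x y; rewrite !inE => /eqP -> /eqP ->.
(* Induction step: the root gets [k] new leaves, the nonzero letters, and the old tree is hung below
   [ord0]; this adds [k] leaves. *)
pose t := [seq [:: lift ord0 a] | a <- enum 'I_k].
have tP w : w \in t -> exists2 a, a != ord0 & w = [:: a].
  by case/mapP => a _ ->; exists (lift ord0 a).
exists (t ++ map (cons ord0) s); split.
- have ut : uniq t.
    rewrite map_inj_uniq ?enum_uniq // => a b.
    by move=> /(congr1 (head ord0)) /lift_inj.
  rewrite cat_uniq ut map_inj_uniq ?us ?andbT /=; last by move=> v w [].
  apply/hasPn => _ /mapP[w _ ->].
  by apply/negP => /tP[a /eqP na [ea _]]; apply: na.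
- by rewrite size_cat 2!size_map size_enum_ord ss mulnS addnS.
- move=> x; have [x0|x0] := eqVneq (x 0) ord0.
    have [w [y [ws e]]] := cs (x \o succn).
    exists (ord0 :: w), y; split; first by rewrite mem_cat map_f ?orbT.
    by rewrite (prepend1 x) x0 e.
  exists [:: x 0], (x \o succn); split; last exact: prepend1.
  have [a ea _] : {a | x 0 = lift ord0 a & unlift ord0 (x 0) = Some a}.
    by apply: unlift_some; rewrite eq_sym.
  by rewrite ea mem_cat map_f ?mem_enum.
- move=> v w x y; rewrite !mem_cat => /orP[/tP[a a0 ->]|/mapP[v' v's ->]].
    move=> /orP[/tP[b _ ->] e|/mapP[w' _ ->] e].
      by rewrite (congr1 (fun z => z 0) e : a = b).
    by rewrite (congr1 (fun z => z 0) e : a = ord0) eqxx in a0.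
  move=> /orP[/tP[b b0 ->] e|/mapP[w' w's ->] e].
    by rewrite -(congr1 (fun z => z 0) e : ord0 = b) eqxx in b0.
  congr cons; apply: (ps v' w' x y) => //; apply: (@prependI _ [:: ord0]).
  by rewrite -!prependD.
Qed.

(** * Substituting code words for letters *)

Section Substitution.
Variables k K : nat.
Hypothesis K_gt1 : 1 < K.
Variable s : 'I_K -> seq 'I_k.
Hypothesis s_complete : forall x, exists a y, x = prepend (s a) y.
Hypothesis s_prefix :
  forall a b x y, prepend (s a) x = prepend (s b) y -> a = b.
Variable c : 'I_k.

(** An empty code word would be a prefix of every end, so by [s_prefix] all letters would coincide,
    against [1 < K]. *)
Lemma code_word_nonempty a : 0 < size (s a).
Proof.
case sa : (s a) => //; pose x (_ : nat) := c.
have eqa b : a = b by apply: (@s_prefix _ _ (prepend (s b) x) x); rewrite sa.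
pose i0 := Ordinal (ltnW K_gt1); pose i1 := Ordinal K_gt1.
by have := congr1 val (etrans (esym (eqa i0)) (eqa i1)).
Qed.

Fixpoint subst_upto m (x : nat -> 'I_K) : nat -> 'I_k :=
  if m is m'.+1 then prepend (s (x 0)) (subst_upto m' (x \o succn))
  else fun=> c.

(** The infinite concatenation of the code words, computed with finite fuel: [j.+1] nonempty code
    words already cover position [j], so the filler [c] is never seen. *)
Definition subst (x : nat -> 'I_K) j := subst_upto j.+1 x j.

Lemma subst_upto_stable m m' x j : j < m -> j < m' ->
  subst_upto m x j = subst_upto m' x j.
Proof.
elim: m m' x j => // m IH [//|m'] x j; rewrite !ltnS => jm jm' /=.
apply: prepend_local => [|i ij]; first exact: code_word_nonempty.
by apply: IH; exact: leq_trans ij _.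
Qed.

Lemma subst_unfold x : subst x = prepend (s (x 0)) (subst (x \o succn)).
Proof.
apply/funext => j; rewrite {1}/subst /=.
apply: prepend_local => [|i ij]; first exact: code_word_nonempty.
exact: subst_upto_stable.
Qed.

Definition subst_word (w : seq 'I_K) := flatten (map s w).

Lemma subst_prepend w x :
  subst (prepend w x) = prepend (subst_word w) (subst x).
Proof. by elim: w => //= a w IH; rewrite subst_unfold /= IH -prependD. Qed.

Lemma subst_inj : injective subst.
Proof.
move=> x y e; apply/funext => j; elim: j x y e => [|j IH] x y.
  by rewrite [subst x]subst_unfold [subst y]subst_unfold => /s_prefix.
rewrite [subst x]subst_unfold [subst y]subst_unfold => e.
have xy0 := s_prefix e; rewrite xy0 in e.
exact: IH (prependI e).
Qed.

Lemma subst_surj z : exists x, subst x = z.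
Proof.
pose P z (r : 'I_K * (nat -> 'I_k)) := z = prepend (s r.1) r.2.
have /boolp.choice[d dP] y : exists r, P y r.
  by have [a [r e]] := s_complete y; exists (a, r).
(* Decoding: [d] splits off one code word, and the [j]-th letter is read after [j] such splits. *)
pose x z j := (d (iter j (fun y => (d y).2) z)).1.
have xS y : x y \o succn = x (d y).2.
  by apply/funext => j; rewrite /x [LHS]/comp iterSr.
exists (x z); apply/funext => j.
(* The first code word agrees on both sides and is nonempty, so position [j] involves only earlier
   positions of the tail. *)
elim/ltn_ind: j z => j IH z.
rewrite subst_unfold xS [RHS](congr1 (@^~ j) (dP z)).
apply: prepend_local => [|i ij]; first exact: code_word_nonempty.
exact: IH.
Qed.

Variable n : nat.

Definition subst_ends (x : ends n K) : ends n k := fun i => subst (x i).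
Definition subst_words (w : word n K) : word n k := fun i => subst_word (w i).

Lemma subst_wact p x :
  subst_ends (wact p x) = wact (subst_words p) (subst_ends x).
Proof. by apply/funext => i; exact: subst_prepend. Qed.

Lemma subst_ends_bij : exists inv, cancel subst_ends inv /\ cancel inv subst_ends.
Proof.
have /boolp.choice[inv invP] := subst_surj.
exists (fun z i => inv (z i)).
split=> x; apply/funext => i; last exact: invP.
by apply: subst_inj; rewrite invP.
Qed.

(** * Conjugation by the substitution *)

Section Conjugation.
Variable inv : ends n k -> ends n K.
Hypotheses (substK : cancel subst_ends inv) (invK : cancel inv subst_ends).

Definition conj_subst (g : sym (ends n K)) : sym (ends n k) :=
  Sym (can_comp substK (can_comp (sym_funK g) invK))
      (can_comp substK (can_comp (sym_invK g) invK)).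

(** By [BHT_table] only the domain side needs a code. Disjointness and covering of cylinders pass
    from [C] to its image because [subst_ends] is a bijection. *)
Lemma conj_subst_BHT g : g \in @BHT n K -> conj_subst g \in @BHT n k.
Proof.
pose x0 : ends n k := fun _ _ => c.
move=> /(BHT_table (inv x0))[C [finC mC tab]]; have [jC _] := mC.
apply/(BHT_table x0); exists (subst_words @` C)%classic; split.
- exact: finite_image.
- apply: (covers_maximal x0).
    apply: (joinless_wact x0) => _ _ x y [p Cp <-] [q Cq <-].
    rewrite -(invK x) -(invK y) -!subst_wact => /(can_inj substK) e.
    by rewrite (joinless_compat jC Cp Cq (wact_compat e)).
  move=> x; have [p [y [Cp e]]] := maximal_covers finC mC (inv x).
  exists (subst_words p), (subst_ends y); split; first by exists p.
  by rewrite -subst_wact -e invK.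
- move=> _ [p Cp <-]; have [q pq] := tab p Cp.
  exists (subst_words q) => x /=.
  by rewrite -(invK x) -!subst_wact /= substK pq.
Qed.

Definition nG_subst (g : nG n K) : nG n k := NG (conj_subst_BHT (nG_valP g)).

Lemma nG_substM : {morph nG_subst : g h / (g * h)%g}.
Proof.
move=> g h; apply: val_inj; apply: sym_eq => x /=.
by rewrite substK.
Qed.

Lemma nG_subst_inj : injective nG_subst.
Proof.
move=> g h e; apply: val_inj; apply: sym_eq => x.
have := congr1 (fun f : nG n k => f (subst_ends x)) e.
by rewrite /= substK => /(can_inj substK).
Qed.

End Conjugation.
End Substitution.

(** * The embedding of groups *)

Lemma injective_isomorphic_to_subgroup (G H : groupType) (f : G -> H) :
  {morph f : x y / (x * y)%g} -> injective f -> isomorphic_to_subgroup G H.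
Proof.
move=> fM injf.
pose phi : {multiplicative G -> H} :=
  HB.pack f (isMultiplicative.Build G H f fM).
exists (fun y => `[< exists x, phi x = y >]).
  have f1 : phi 1%g = 1%g.
    by apply: (mulgI (phi 1%g)); rewrite -gmulfM !mulg1.
  split; first by apply/asboolP; exists 1%g.
  move=> _ _ /asboolP[x <-] /asboolP[y <-]; apply/asboolP.
  exists (x / y)%g; rewrite gmulfM; congr (_ * _)%g.
  by apply: (mulgI (phi y)); rewrite -gmulfM !mulgV.
by exists phi; split=> // y; split=> [/asboolP|h]; last exact/asboolP.
Qed.

(** The parameters are shifted: [k.+2] is the small alphabet size, and [(k.+1 * N).+1] is the number
    of leaves of the comb tree over it. *)
Lemma nG_embed n k N : 0 < N ->
  isomorphic_to_subgroup (nG n (k.+1 * N).+1) (nG n k.+2).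
Proof.
move=> N0; have [s [us ss cs ps]] := complete_prefix_code k.+1 N.
have K_gt1 : 1 < (k.+1 * N).+1 by rewrite ltnS muln_gt0.
pose t (a : 'I_(k.+1 * N).+1) := nth [::] s a.
have t_complete x : exists a y, x = prepend (t a) y.
  have [w [y [ws ->]]] := cs x.
  have ws' : index w s < (k.+1 * N).+1 by rewrite -ss index_mem.
  by exists (Ordinal ws'), y; rewrite /t /= nth_index.
have t_prefix a b x y : prepend (t a) x = prepend (t b) y -> a = b.
  have lt_s (d : 'I_(k.+1 * N).+1) : d < size s by rewrite ss.
  move=> e; apply: val_inj; apply: (uniqP [::] us); try exact: lt_s.
  by apply: ps e; exact: mem_nth.
have [inv [substK invK]] := subst_ends_bij K_gt1 t_complete t_prefix ord0 n.
apply: (injective_isomorphic_to_subgroup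
  (nG_substM K_gt1 t_prefix substK invK)).
exact: nG_subst_inj.
Qed.

Theorem theorem4p5 (n : nat) (hn : 2 <= n) :
  (forall k K N : nat, 2 <= k -> k < K -> 1 <= N -> K = 1 + (k - 1) * N ->
     isomorphic_to_subgroup (nG n K) (nG n k)) /\
  (forall K : nat, 2 < K -> isomorphic_to_subgroup (nG n K) (nG n 2)).
Proof.
split=> [[|[|k]] // K N _ _ N0 ->|[|K] // K2].
  by rewrite subn1 add1n; exact: nG_embed.
(* Over two letters each inner node adds one leaf. Here [K] is the original size less one, and it
   serves as [N]. *)
by rewrite -[K]mul1n; apply: nG_embed; apply: ltnW.
Qed.
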